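(* Let $n$ be an even positive integer and let $G_n$ be the unitary addition Cayley graph on $\mathbb{Z}_n$. Then the characteristic polynomial of $G_n$ is $$\phi(G_n) = \big(x^2 - \varphi(n)^2\big) \prod_{r=1}^{\lfloor \frac{n-1}{2} \rfloor} \big(x^2 - |\lambda_r|^2\big),$$ where $\varphi$ is Euler's totient function and $\lambda_r = \sum_{0 \le j \le n-1,\ \gcd(j,n)=1} w^{rj}$ with $w = e^{2\pi \sqrt{-1}/n}$. In particular, the eigenvalues of $G_n$ are $\pm\varphi(n)$ and $\pm|\lambda_r|$ for $r = 1, \dots, \lfloor \frac{n-1}{2} \rfloor$.
   Context: The unitary addition Cayley graph $G_n$ is the simple graph (no loops) with vertex set $\mathbb{Z}_n = \{0,1,\dots,n-1\}$ in which two distinct vertices $a,b$ are adjacent if and only if $a+b \in U(n)$, where $U(n)$ is the set of units of the ring $\mathbb{Z}_n$. The characteristic polynomial $\phi(G)$ of a graph $G$ is $\det(xI - A(G))$, where $A(G)$ is its $0$-$1$ adjacency matrix; the eigenvalues of $G$ are those of $A(G)$. Euler's totient function is written $\varphi$ here to distinguish it from the characteristic polynomial $\phi$. *)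

(* Defs.v *)
From HB Require Import structures.
From mathcomp Require Import all_boot all_order all_algebra.
From mathcomp Require Import all_classical all_reals all_analysis.
From mathcomp Require Import complex.
Set Implicit Arguments.
Unset Strict Implicit.
Unset Printing Implicit Defensive.
Import Order.TTheory GRing.Theory Num.Theory.
Local Open Scope ring_scope.
Local Open Scope complex_scope.

(* A simple graph on a finite type T is given by its (symmetric, irreflexive)
   adjacency relation.  Rows and columns of the adjacency matrix are indexed
   through the canonical enumeration of T. *)
Definition adjmx (F : nzRingType) (T : finType) (e : rel T) : 'M[F]_#|T| :=
  \matrix_(i, j) (e (enum_val i) (enum_val j))%:R.

(* 'Z_n is the ring Z/nZ only when 1 < n. *)
Definition unitary_addition_cayley (n : nat) : rel 'Z_n :=
  fun a b => (a != b) && (a + b \is a GRing.unit).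

Lemma unitary_addition_cayley_sym n : symmetric (@unitary_addition_cayley n).
Proof. by move=> a b; rewrite /unitary_addition_cayley eq_sym addrC. Qed.

Lemma unitary_addition_cayley_irr n : irreflexive (@unitary_addition_cayley n).
Proof. by move=> a; rewrite /unitary_addition_cayley eqxx. Qed.

Definition cexp (R : realType) (z : R[i]) : R[i] :=
  (expR (complex.Re z))%:C * (cos (complex.Im z) +i* sin (complex.Im z)).

Definition root_unity (R : realType) (n : nat) : R[i] :=
  cexp (2 * (pi : R)%:C * 'i / n%:R).

Lemma root_unityE (R : realType) (n : nat) :
  root_unity R n = cos (2 * pi / n%:R) +i* sin (2 * pi / n%:R).
Proof.
have -> : root_unity R n = cexp (0 +i* (2 * pi / n%:R)).
  rewrite /root_unity; congr cexp.
  have E (x : R) : 0 +i* x = 'i * x%:C.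
    by simpc.
  rewrite E !rmorphM fmorphV !rmorph_nat /=.
  by rewrite [LHS]mulrAC [RHS]mulrC.
by rewrite /cexp /= expR0 mul1r.
Qed.

Definition lam (R : realType) (n r : nat) : R[i] :=
  \sum_(0 <= j < n | coprime j n) root_unity R n ^+ (r * j).

(* Main.v *)
Require Import Defs.
From HB Require Import structures.
From mathcomp Require Import all_boot all_order all_algebra.
From mathcomp Require Import all_classical all_reals all_analysis.
From mathcomp Require Import complex.
From mathcomp Require Import zify ring lra.
Import Order.TTheory GRing.Theory Num.Theory.
Local Open Scope ring_scope.
Local Open Scope complex_scope.

(* On the additive characters chi_k(a) = w^(k a) of Z/n the matrix
   (unit(a + b)) acts by chi_k |-> lambda_k chi_(-k), and lambda_(-k) = lambda_k
   is real.  Hence chi_k + chi_(-k) and chi_k - chi_(-k) are eigenvectors for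
   lambda_k and -lambda_k.  One such vector per residue k gives an orthogonal
   basis, so the characteristic polynomial splits accordingly; k and n - k
   contribute X^2 - lambda_k^2, while the self-paired residues 0 and n/2
   contribute X - phi(n) and X + phi(n) because units modulo an even n are
   odd. *)

(** * Characteristic polynomial from a basis of left eigenvectors *)

Lemma char_poly_diagonalized (F : fieldType) (n : nat) (A P : 'M[F]_n)
    (d : 'rV[F]_n) :
  P \in unitmx -> P *m A = diag_mx d *m P ->
  char_poly A = \prod_i ('X - (d 0 i)%:P).
Proof.
move=> Pu PA; pose Q := map_mx polyC P.
have Q0 : \det Q != 0.
  by rewrite det_map_mx polyC_eq0 -unitfE -unitmxE.
(* [\det Q] is a nonzero constant polynomial, so it can be cancelled after multiplying both sides by
   it. *)
apply: (mulfI Q0); rewrite /char_poly -det_mulmx /char_poly_mx mulmxBr.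
rewrite -map_mxM PA map_mxM /= -/Q scalar_mxC -mulmxBl det_mulmx mulrC.
congr (_ * _).
have -> : 'X%:M - map_mx polyC (diag_mx d) = diag_mx (\row_i ('X - (d 0 i)%:P)).
  apply/matrixP=> i j; rewrite !mxE; case: eqP => [->|_].
    by rewrite !mulr1n.
  by rewrite !mulr0n polyC0 subr0.
by rewrite det_diag; apply: eq_bigr => i _; rewrite mxE.
Qed.

(** The rows of [P] are the [f k]. Orthogonality for the bilinear form, without conjugation, makes
    [P *m P^T] diagonal with nonzero entries, so [P] is invertible. *)
Lemma char_poly_adjmx (F : fieldType) (T : finType) (e : rel T)
    (f : T -> T -> F) (d c : T -> F) :
  (forall k b, \sum_a f k a * (e a b)%:R = d k * f k b) ->
  (forall k l, \sum_a f k a * f l a = (if k == l then c k else 0)) ->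
  (forall k, c k != 0) ->
  char_poly (adjmx F e) = \prod_k ('X - (d k)%:P).
Proof.
move=> fd fo c0.
pose P : 'M[F]_#|T| := \matrix_(i, j) f (enum_val i) (enum_val j).
have reT (G : T -> F) : \sum_(i < #|T|) G (enum_val i) = \sum_a G a.
  by rewrite [RHS](reindex _ (onW_bij _ (enum_val_bij T))).
rewrite (@char_poly_diagonalized _ _ _ P (\row_i d (enum_val i))).
- rewrite [RHS](reindex _ (onW_bij _ (enum_val_bij T))).
  by apply: eq_bigr => i _; rewrite mxE.
- have PP : P *m P^T = diag_mx (\row_i c (enum_val i)).
    apply/matrixP => i j; rewrite !mxE.
    under eq_bigr do rewrite !mxE.
    rewrite (reT (fun a => f (enum_val i) a * f (enum_val j) a)) fo.
    by rewrite (inj_eq enum_val_inj); case: eqP.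
  have : P *m P^T \in unitmx.
    by rewrite PP unitmxE det_diag unitfE; apply/prodf_neq0 => i _; rewrite mxE.
  by rewrite unitmx_mul => /andP[].
- rewrite mul_diag_mx; apply/matrixP => i j; rewrite !mxE.
  under eq_bigr do rewrite !mxE.
  by rewrite (reT (fun a => f (enum_val i) a * (e a (enum_val j))%:R)) fd.
Qed.

(** * Additive characters of Z/n and their sums over units *)

Section RootOfUnity.

Variables (F : numClosedFieldType) (p : nat) (w : F).
Local Notation n := p.+2.
Hypothesis w_prim : n.-primitive_root w.
Implicit Types x y k a : 'Z_n.

Definition zchar k : F := w ^+ k.

Lemma zchar0 : zchar 0 = 1. Proof. by []. Qed.

Lemma zcharD x y : zchar (x + y) = zchar x * zchar y.
Proof. by rewrite /zchar -exprD -(prim_expr_mod w_prim (x + y)). Qed.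

Lemma zchar_nat i : zchar i%:R = w ^+ i.
Proof. by rewrite /zchar val_Zp_nat // prim_expr_mod. Qed.

Lemma zchar_eq1 k : (zchar k == 1) = (k == 0).
Proof.
by rewrite /zchar -(prim_order_dvd w_prim) /dvdn modn_small ?ltn_ord.
Qed.

Lemma sum_zchar k : \sum_a zchar (k * a) = (if k == 0 then n%:R else 0).
Proof.
case: eqP => [->|/eqP k0].
  under eq_bigr do rewrite mul0r zchar0.
  by rewrite sumr_const card_ord.
(* The shift a -> a + 1 permutes Z/n and multiplies the sum by [zchar k]. *)
have : (zchar k - 1) * \sum_a zchar (k * a) = 0.
  apply/eqP; rewrite mulrBl mul1r mulr_sumr subr_eq0; apply/eqP.
  rewrite [RHS](reindex_inj (addIr 1)) /=.
  by apply: eq_bigr => a _; rewrite -zcharD mulrDr mulr1 addrC.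
by move/eqP; rewrite mulf_eq0 subr_eq0 zchar_eq1 (negPf k0) => /eqP.
Qed.

(** The Ramanujan sum c_n(k), that is, lambda_k indexed by residues. *)
Definition usum k : F := \sum_(a : 'Z_n | a \is a GRing.unit) zchar (k * a).

Lemma usumN k : usum (- k) = usum k.
Proof.
rewrite /usum (reindex_inj oppr_inj) /=.
by apply: eq_big => a; rewrite ?unitrN // mulrNN.
Qed.

Lemma zcharN x : zchar (- x) = (zchar x)^-1.
Proof. by apply/esym/mulr1_eq; rewrite -zcharD subrr zchar0. Qed.

Lemma zchar_conj x : Num.conj (zchar x) = zchar (- x).
Proof.
have w1 : `|w| = 1.
  apply/eqP; rewrite -(pexpr_eq1 (n:=n)) ?normr_ge0 //.
  by rewrite -normrX prim_expr_order // normr1.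
by rewrite zcharN invC_norm /zchar normrX w1 !expr1n invr1 mul1r.
Qed.

(** Conjugation turns chi_k into chi_(-k), which leaves the sum unchanged by [usumN]; hence [usum k]
    is real. *)
Lemma usum_norm k : `|usum k| ^+ 2 = usum k ^+ 2.
Proof.
rewrite normCK -[RHS]/(usum k * usum k); congr (_ * _).
rewrite -[RHS]usumN /usum rmorph_sum.
by apply: eq_bigr => a _; rewrite mulNr; apply: zchar_conj.
Qed.

Lemma sum_unit_zchar k b :
  \sum_(a : 'Z_n) zchar (k * a) * (a + b \is a GRing.unit)%:R =
  usum k * zchar (- (k * b)).
Proof.
rewrite (reindex_inj (addIr (- b))) /usum mulr_suml [RHS]big_mkcond /=.
apply: eq_bigr => a _; rewrite subrK mulrBr zcharD.
by case: ifP; rewrite ?mulr1 ?mulr0.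
Qed.

(** * Even modulus n = 2h: signed combinations of characters as eigenvectors *)

Variable (h : nat).
Hypothesis n_double : n = h.*2.

(* Each pair {k, -k} with k != -k must yield both chi_k + chi_(-k) and
   chi_k - chi_(-k): the representative k <= n/2 takes the sum, the other the
   difference. *)
Definition zsgn k : F := if (k <= h)%N then 1 else -1.

Definition eigfun k a : F := zchar (k * a) + zsgn k * zchar (- (k * a)).

Lemma zsgn_sqr k : zsgn k * zsgn k = 1.
Proof. by rewrite /zsgn; case: ifP; rewrite ?mulrNN mulr1. Qed.

(** The residues k and n - k lie on opposite sides of h. *)
Lemma zsgnN k : k != - k -> zsgn (- k) = - zsgn k.
Proof.
rewrite /zsgn -val_eqE; case: k => k; rewrite /Zp_trunc /= => kn.
have [->|k0] := posnP k; first by rewrite subn0 modnn.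
rewrite (@modn_small (n - k)); last by lia.
case: (leqP k h); case: (leqP (n - k) h); rewrite ?opprK // => h1 h2 /eqP [];
lia.
Qed.

(** The self-paired residues are 0 and h, both at most h. The sign -1 there would make [eigfun k]
    vanish. *)
Lemma zsgn_fix k : k = - k -> zsgn k = 1.
Proof.
rewrite /zsgn => /(congr1 val); case: k => k; rewrite /Zp_trunc /= => kn.
have [->|k0] := posnP k; first by [].
by rewrite modn_small; case: (leqP k h) => //; lia.
Qed.

(** Both 2a and n are even; hence the matrix (unit(a + b)) has zero diagonal and is the adjacency
    matrix. *)
Lemma nonunit_double a : a + a \isn't a GRing.unit.
Proof.
rewrite -(natr_Zp a) -natrD unitZpE // addnn.
move: (nat_of_ord a) => {}a.
by rewrite n_double -!muln2 coprimeMl !coprimeMr !andbF.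
Qed.

Lemma unitary_addition_cayleyE a b :
  @unitary_addition_cayley n a b = (a + b \is a GRing.unit).
Proof.
rewrite /unitary_addition_cayley; case: eqP => //= ->.
by rewrite (negPf (nonunit_double b)).
Qed.

Lemma eigfun_eigen k b :
  \sum_a eigfun k a * (@unitary_addition_cayley n a b)%:R =
  zsgn k * usum k * eigfun k b.
Proof.
under eq_bigr do rewrite unitary_addition_cayleyE mulrDl -mulrA -mulNr.
rewrite big_split -mulr_sumr /= !sum_unit_zchar usumN mulNr opprK /eigfun.
by rewrite -[X in X + _]mul1r -(zsgn_sqr k); ring.
Qed.

(** The product expands into characters of frequencies k + l, -(k + l), k - l and l - k. For k = l
    the last two give 2n times the sign, and the first two give 2n exactly when 2k = 0. *)
Lemma eigfun_orth k l :
  \sum_a eigfun k a * eigfun l a =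
  (if k == l then zsgn k *+ 2 * n%:R + (k == - k)%:R *+ 2 * n%:R else 0).
Proof.
have E a : eigfun k a * eigfun l a =
   zchar ((k + l) * a) + zsgn k * zsgn l * zchar (- (k + l) * a)
   + zsgn l * zchar ((k - l) * a) + zsgn k * zchar ((l - k) * a).
  by rewrite /eigfun mulNr !(mulrDl _ _ a) !(mulNr _ a) opprD !zcharD; ring.
under eq_bigr do rewrite E.
rewrite !big_split -!mulr_sumr /= !sum_zchar oppr_eq0 !subr_eq0 addr_eq0.
move: (n%:R : F) => N.
rewrite (eq_sym l); case: (eqVneq k l) => [<-|kl].
  case: (eqVneq k (-k)) => [/zsgn_fix ->|_]; rewrite /= ?mulr2n; ring.
(* For l = -k the sums of frequencies k + l and -(k + l) have opposite coefficients and cancel. *)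
case: (eqVneq k (-l)) => [kNl|_]; last by ring.
rewrite kNl zsgnN; last by rewrite -kNl eq_sym.
rewrite !mulNr zsgn_sqr; ring.
Qed.

Lemma char_poly_usum :
  char_poly (adjmx F (@unitary_addition_cayley n)) =
  \prod_(k : 'Z_n) ('X - (zsgn k * usum k)%:P).
Proof.
apply: char_poly_adjmx eigfun_eigen eigfun_orth _ => k.
rewrite -mulrDl mulf_neq0 ?pnatr_eq0 //.
(* The coefficient of n is 4 at a self-paired residue, and 2 or -2 elsewhere. *)
case: (eqVneq k (-k)) => [/zsgn_fix ->|_].
  by rewrite /= -mulrnDr pnatr_eq0.
rewrite mul0rn addr0 mulrn_eq0 /= /zsgn.
by case: ifP; rewrite ?oppr_eq0 oner_eq0.
Qed.

Lemma usum_nat i :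
  usum i%:R = \sum_(0 <= j < n | coprime j n) w ^+ (i * j).
Proof.
rewrite big_mkord; apply: eq_big => j.
  by rewrite -[in LHS](natr_Zp j) unitZpE // coprime_sym.
by rewrite -[in LHS](natr_Zp j) -natrM zchar_nat.
Qed.

Lemma usum0 : usum 0 = (totient n)%:R.
Proof.
rewrite -[0]/(0%:R) usum_nat totient_count_coprime natr_sum big_mkcond.
by apply: eq_bigr => j _; rewrite coprime_sym expr0; case: coprime.
Qed.

(** w^h is a square root of 1 other than 1, since n does not divide h. Every j coprime to the even n
    is odd, so each term w^(h j) is -1. *)
Lemma usum_half : usum h%:R = - (totient n)%:R.
Proof.
have wh : w ^+ h = -1.
  have : (w ^+ h) ^+ 2 == 1 by rewrite -exprM muln2 -n_double prim_expr_order.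
  rewrite sqrf_eq1 -(prim_order_dvd w_prim) => /orP[|/eqP //].
  by move/dvdn_leq; lia.
rewrite -usum0 -[0]/(0%:R) !usum_nat -sumrN; apply: eq_bigr => j nj.
have jodd : odd j.
  have : coprime j 2.
    by apply: coprime_dvdr nj; rewrite n_double -muln2 dvdn_mull.
  by rewrite coprimen2.
by rewrite exprM wh expr0 -signr_odd jodd.
Qed.

Lemma char_poly_unitary_addition_cayley :
  char_poly (adjmx F (@unitary_addition_cayley n)) =
  ('X^2 - ((totient n)%:R ^+ 2)%:P) *
  \prod_(1 <= r < h) ('X^2 - (`|usum r%:R| ^+ 2)%:P).
Proof.
have h0 : (0 < h)%N by lia.
have pair (x : F) : ('X - x%:P) * ('X - (- x)%:P) = 'X^2 - (x ^+ 2)%:P.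
  by rewrite polyCN opprK polyC_exp; ring.
pose G i : {poly F} := 'X - ((if (i <= h)%N then 1 else -1) * usum i%:R)%:P.
rewrite char_poly_usum.
transitivity (\prod_(0 <= i < h.*2) G i).
  rewrite -n_double big_mkord; apply: eq_bigr => k _.
  by rewrite /G /zsgn natr_Zp.
(* After splitting at h, the leading factors of the two blocks, of indices 0 and h, give X - phi(n)
   and X + phi(n). *)
rewrite -addnn [LHS](@big_cat_nat _ _ _ h) ?leq_addr //=.
rewrite big_ltn // [X in _ * X]big_ltn; last by lia.
rewrite mulrACA; congr (_ * _).
  by rewrite /G leqnn leq0n !mul1r usum_half usum0 pair.
(* Reversing the upper block aligns n - i, of sign -1, with i, of sign 1. *)
rewrite [X in _ * X]big_nat_rev /= -[h.+1]add1n big_addn addnK -big_split /=.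
rewrite big_nat [RHS]big_nat; apply: eq_bigr => i /andP[i1 ih].
rewrite /G usum_norm.
have -> : ((1 + h + (h + h) - (i + h).+1) = n - i)%N by lia.
have -> : (i <= h)%N by lia.
have -> : (n - i <= h)%N = false by lia.
have -> : (n - i)%:R = - i%:R :> 'Z_n.
  by rewrite natrB ?pchar_Zp ?sub0r //; lia.
by rewrite usumN mul1r mulN1r pair.
Qed.

End RootOfUnity.

(** * Primitivity of the complex root of unity *)

Lemma de_moivre (R : realType) (x : R) (k : nat) :
  (cos x +i* sin x) ^+ k = cos (x *+ k) +i* sin (x *+ k).
Proof.
elim: k => [|k IH]; first by rewrite mulr0n cos0 sin0.
by rewrite exprS IH mulrS cosD sinD; simpc; rewrite [sin x * _ + _]addrC.
Qed.

(** The order m divides n. If m < n, then 0 < pi m/n < pi gives sin(pi m/n) > 0, against 1 = cos(2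
    pi m/n) = 1 - 2 sin^2(pi m/n). *)
Lemma root_unity_prim (R : realType) (n : nat) :
  (0 < n)%N -> n.-primitive_root (root_unity R n).
Proof.
move=> n0; have nR : (n%:R : R) != 0 by rewrite pnatr_eq0 -lt0n.
have wn : root_unity R n ^+ n = 1.
  rewrite root_unityE de_moivre.
  have -> : 2 * pi / n%:R *+ n = pi *+ 2 :> R.
    by rewrite -[LHS]mulr_natr divfK // mulr_natl.
  by rewrite cos2pi sin2pi.
have [m m_prim mn] := prim_order_exists n0 wn.
suff mE : m = n by move: m_prim; rewrite mE.
have m0 := prim_order_gt0 m_prim.
apply/eqP; rewrite eqn_leq dvdn_leq //= leqNgt; apply/negP => ltmn.
have := prim_expr_order m_prim; rewrite root_unityE de_moivre => -[].
have -> : 2 * pi / n%:R *+ m = (pi * (m%:R / n%:R)) *+ 2 :> R.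
  by rewrite -mulr_natr -[RHS]mulr_natr; ring.
have s0 : 0 < sin (pi * (m%:R / n%:R) : R).
  apply: sin_gt0_pi; rewrite mulr_gt0 ?pi_gt0 ?divr_gt0 ?ltr0n //=.
  by rewrite gtr_pMr ?pi_gt0 // ltr_pdivrMr ?ltr0n // mul1r ltr_nat.
rewrite cos_mulr2n cos2sin2 => c1 _.
have : sin (pi * (m%:R / n%:R) : R) ^+ 2 = 0 by lra.
by move/eqP; rewrite sqrf_eq0 gt_eqF.
Qed.

Theorem theorem4p3 (R : realType) (n : nat) (n_gt0 : (0 < n)%N)
    (n_even : ~~ odd n) :
  let A : 'M[R[i]]_#|'Z_n| := adjmx R[i] (@unitary_addition_cayley n) in
  let m : nat := ((n - 1) %/ 2)%N in
  char_poly A =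
    ('X^2 - ((totient n)%:R ^+ 2)%:P) *
      \prod_(1 <= r < m.+1) ('X^2 - (`|lam R n r| ^+ 2)%:P)
  /\
  (forall x : R[i], eigenvalue A x <->
     [\/ x = (totient n)%:R, x = - (totient n)%:R |
      exists r : nat, (1 <= r <= m)%N /\
        (x = `|lam R n r| \/ x = - `|lam R n r|)]).
Proof.
move=> A m.
have charA : char_poly A = ('X^2 - ((totient n)%:R ^+ 2)%:P) *
      \prod_(1 <= r < m.+1) ('X^2 - (`|lam R n r| ^+ 2)%:P).
  have w_prim := root_unity_prim R _ n_gt0.
  (* Positivity rules out n = 0 and parity rules out n = 1, so ['Z_n] is really Z/n. *)
  rewrite {}/A {}/m; case: n n_gt0 n_even w_prim => [|[|p]] // _ p_even w_prim.
  have n_double : p.+2 = (p.+2)./2.*2 by rewrite even_halfK.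
  rewrite (char_poly_unitary_addition_cayley _ _ _ w_prim _ n_double).
  congr (_ * _).
  (* For even n, floor((n - 1)/2) = n/2 - 1, so both products stop just before n/2. *)
  have -> : ((p.+2 - 1) %/ 2).+1 = (p.+2)./2 by lia.
  by apply: eq_bigr => r _; rewrite (usum_nat _ _ _ w_prim).
(* The eigenvalues are the roots of the characteristic polynomial, read off factor by factor. *)
split=> // x; rewrite eigenvalue_root_char charA rootM.
have rootX2 (y : R[i]) : root ('X^2 - (y ^+ 2)%:P) x = (x == y) || (x == - y).
  by rewrite /root !hornerE subr_eq0 eqf_sqr.
have root_prod s : root (\prod_(r <- s) ('X^2 - (`|lam R n r| ^+ 2)%:P)) x =
    has (fun r => (x == `|lam R n r|) || (x == - `|lam R n r|)) s.
  elim: s => [|r s IH] /=; first by rewrite big_nil (negPf (root1 _)).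
  by rewrite big_cons rootM IH rootX2.
rewrite rootX2 root_prod; split.
  case/orP => [/orP[/eqP ->|/eqP ->]|/hasP[r]].
  - by constructor 1.
  - by constructor 2.
  rewrite mem_index_iota => rm /orP xr; constructor 3; exists r; split=> //.
  by case: xr => /eqP; [left|right].
case=> [->|->|[r [rm xr]]]; rewrite ?eqxx ?orbT //.
apply/orP; right; apply/hasP; exists r; first by rewrite mem_index_iota.
by case: xr => ->; rewrite eqxx ?orbT.
Qed.
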